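(* Let $P$ be a finite set of prime numbers with at least two elements, let $p$ be the largest element of $P$, and let $c>0$ be a real number. Define $$A_-=\left\{n\in\mathbb{Z}_+:\ \max_{i\in P} s_i(n)=s_p(n)\right\},\qquad A_+=\left\{n\in\mathbb{Z}_+:\ \max_{i\in P} s_i(n)-s_p(n)\ge c\right\}.$$ Then there is no integer $k\ge 2$ and no deterministic finite automaton with output $(Q,\{0,\dots,k-1\},\rho,q_0,\Delta,\tau)$ such that $\tau(\rho(q_0,[n]_k))$ takes one value for all $n\in A_-$ and a different value for all $n\in A_+$.
   Context: $s_q(n)$ denotes the sum of the digits of $n$ in base $q$. $[n]_k$ denotes the string of base-$k$ digits of $n$, written from the most significant digit. A deterministic finite automaton with output (DFAO) is a tuple $(Q,\Sigma,\rho,q_0,\Delta,\tau)$ with $Q$ a finite set of states, $\Sigma$ a finite input alphabet, $\rho:Q\times\Sigma\to Q$ a transition function (extended to words by $\rho(q,s_1s_2\cdots s_m)=\rho(\cdots\rho(\rho(q,s_1),s_2)\cdots,s_m)$), $q_0\in Q$ an initial state, $\Delta$ a finite output alphabet and $\tau:Q\to\Delta$ an output function. *)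

(* Defs.v *)
From mathcomp Require Import all_boot all_order all_algebra finmap.
From mathcomp Require Import reals.

Set Implicit Arguments.
Unset Strict Implicit.
Unset Printing Implicit Defensive.

Import Order.TTheory GRing.Theory Num.Theory.

(* [fuel] bounds the number of digits; [n] itself is enough fuel in base q >= 2
   (see [digitsE]). *)
Fixpoint digits_rec (q fuel n : nat) : seq nat :=
  if fuel is f.+1 then
    if n == 0 then [::] else rcons (digits_rec q f (n %/ q)) (n %% q)
  else [::].

(* Base-q digits, most significant first, without leading zeros;
   0 is represented by the empty word. *)
Definition digits (q n : nat) : seq nat := digits_rec q n n.

Definition digit_sum (q n : nat) : nat := \sum_(d <- digits q n) d.

(* The word [n]_k over {0, ..., k-1}; for k >= 2 the projection [insub] never
   discards a digit (see [val_digit_word]). *)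
Definition digit_word (k n : nat) : seq 'I_k := pmap insub (digits k n).

Lemma digits_rec_fuel (q f g n : nat) :
  1 < q -> n <= f -> n <= g -> digits_rec q f n = digits_rec q g n.
Proof.
move=> q1; elim: f g n => [|f IH] [|g] [|n] //= nf ng.
have lt := ltn_Pdiv q1 (ltn0Sn n).
congr rcons; apply: IH; rewrite -ltnS; exact: leq_trans lt _.
Qed.

Lemma digitsE (q n : nat) : 1 < q -> 0 < n ->
  digits q n = rcons (digits q (n %/ q)) (n %% q).
Proof.
case: n => // n q1 _; rewrite /digits /=; congr rcons.
by apply: digits_rec_fuel => //; rewrite -ltnS; exact: ltn_Pdiv.
Qed.

Lemma digits_value (q n : nat) : 1 < q ->
  foldl (fun v d => v * q + d) 0 (digits q n) = n.
Proof.
move=> q1; elim/ltn_ind: n => -[//|n] IH.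
by rewrite digitsE // foldl_rcons IH ?ltn_Pdiv // -divn_eq.
Qed.

Lemma val_digit_word (k n : nat) : 1 < k -> map val (digit_word k n) = digits k n.
Proof.
move=> k1; rewrite /digit_word pmap_filter; last exact: insubK.
apply/all_filterP; elim/ltn_ind: n => -[//|n] IH.
rewrite digitsE // all_rcons IH ?ltn_Pdiv // andbT.
by rewrite isSome_insub ltn_mod ltnW.
Qed.

Record DFAO (Sigma : finType) := MkDFAO {
  dfao_state : finType;
  dfao_trans : dfao_state -> Sigma -> dfao_state;
  dfao_init : dfao_state;
  dfao_output : finType;
  dfao_out : dfao_state -> dfao_output
}.

Definition dfao_run (Sigma : finType) (M : DFAO Sigma)
    (q : dfao_state M) (w : seq Sigma) : dfao_state M :=
  foldl (@dfao_trans Sigma M) q w.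

Definition dfao_eval (Sigma : finType) (M : DFAO Sigma) (w : seq Sigma) :
    dfao_output M :=
  dfao_out (dfao_run (dfao_init M) w).

Definition max_digit_sum (P : {fset nat}) (n : nat) : nat :=
  \max_(i <- P) digit_sum i n.

Definition in_A_minus (P : {fset nat}) (p n : nat) : Prop :=
  0 < n /\ max_digit_sum P n = digit_sum p n.

Definition in_A_plus (R : realType) (P : {fset nat}) (p : nat) (c : R)
    (n : nat) : Prop :=
  0 < n /\ (c <= (max_digit_sum P n)%:R - (digit_sum p n)%:R)%R.

(* Main.v *)
Require Import Defs.
From mathcomp Require Import all_boot all_order all_algebra finmap.
From mathcomp Require Import reals boolp cyclic.

Import Order.TTheory GRing.Theory Num.Theory.

(** Fix a prime [i < p] in [P].  Euler's theorem yields exponents [M_j] such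
    that, for all [W] and [L], [p ^ M_j * k ^ L + W] has bounded base-[p] digit
    sum while its base-[i] digit sum tends to infinity: [p ^ M_(j+1)] and
    [p ^ M_j] agree modulo a power of [i] exceeding [p ^ M_j * k ^ L + W] for
    large [j], so each step adds a nonzero block of base-[i] digits.  Hence
    these numbers end up in [A_+].  On the other hand, for fixed [m] one finds
    [W < k ^ L] such that [m * k ^ L + W] is [-1] modulo a power of [p] of
    almost its own size; almost all its base-[p] digits are [p - 1], and it is
    in [A_-] because [(q - 1) / log q] increases with [q].  Taking [m = p ^ M_j]
    for a state reached by [p ^ M_j] for infinitely many [j], and appending the
    [L] digits of [W], gives the contradiction. *)

Lemma digit_sum0 q : digit_sum q 0 = 0.
Proof. by rewrite /digit_sum big_nil. Qed.

Lemma digit_sum_mulD q x r : 1 < q -> r < q ->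
  digit_sum q (x * q + r) = digit_sum q x + r.
Proof.
move=> q1 rq; have q0 : 0 < q by exact: ltnW.
have [|n0] := posnP (x * q + r).
  move/eqP; rewrite addn_eq0 muln_eq0 (gtn_eqF q0) orbF => /andP[/eqP-> /eqP->].
  by rewrite mul0n !addn0.
rewrite /digit_sum digitsE // divnMDl // divn_small // addn0 modnMDl modn_small //.
by rewrite -cats1 big_cat /= big_seq1.
Qed.

Lemma digit_sum_mulXD q a x y : 1 < q -> y < q ^ a ->
  digit_sum q (x * q ^ a + y) = digit_sum q x + digit_sum q y.
Proof.
move=> q1; have q0 : 0 < q by exact: ltnW.
elim: a y => [|a IH] y ya.
  move: ya; rewrite expn0 ltnS leqn0 => /eqP->.
  by rewrite digit_sum0 muln1 !addn0.
rewrite {1}(divn_eq y q) {3}(divn_eq y q) addnA expnSr mulnA -mulnDl.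
rewrite !digit_sum_mulD ?ltn_mod // IH ?addnA //.
by rewrite ltn_divLR // -expnSr.
Qed.

Lemma digit_sum_gt0 q n : 1 < q -> 0 < n -> 0 < digit_sum q n.
Proof.
move=> q1; have q0 : 0 < q by exact: ltnW.
elim/ltn_ind: n => n IH n0.
rewrite (divn_eq n q) digit_sum_mulD ?ltn_mod //.
have [d0|d0] := posnP (n %/ q); last by rewrite ltn_addr // IH // ltn_Pdiv.
by rewrite d0 digit_sum0 add0n lt0n; apply: contraL n0 => /eqP r0;
  rewrite (divn_eq n q) d0 r0.
Qed.

Lemma digit_sum_expn_predn q a : 1 < q -> digit_sum q (q ^ a).-1 = a * q.-1.
Proof.
move=> q1; have q0 : 0 < q by exact: ltnW.
elim: a => [|a IH]; first by rewrite digit_sum0.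
have -> : (q ^ a.+1).-1 = (q ^ a).-1 * q + q.-1.
  apply/succn_inj; rewrite -addnS !prednK ?expn_gt0 ?q0 // -mulSnr.
  by rewrite prednK ?expn_gt0 ?q0 // expnSr.
by rewrite digit_sum_mulD // ?IH ?mulSn 1?addnC // prednK.
Qed.

Lemma leq_expn2r m n e : m <= n -> m ^ e <= n ^ e.
Proof. by case: e => // e le_mn; rewrite leq_exp2r. Qed.

(** There are at most 1 + log_q n digits, each at most [q - 1]; exponentiating keeps this bound
    inside the naturals. *)
Lemma expn_digit_sum_le q n : 1 < q -> 0 < n ->
  q ^ digit_sum q n <= (q * n) ^ q.-1.
Proof.
move=> q1; have q0 : 0 < q by exact: ltnW.
elim/ltn_ind: n => n IH n0.
rewrite {1}(divn_eq n q) digit_sum_mulD ?ltn_mod // expnD mulnC expnMn.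
apply: leq_mul; first by rewrite leq_pexp2l // -ltnS prednK ?ltn_mod.
have [->|d0] := posnP (n %/ q).
  by rewrite digit_sum0 expn0 expn_gt0 n0.
apply: leq_trans (IH _ (ltn_Pdiv q1 n0) d0) _.
by apply: leq_expn2r; rewrite mulnC leq_trunc_div.
Qed.

Lemma expn_succ_le n r : r <= n -> n.+1 ^ r <= r.+1 * n ^ r.
Proof.
elim: r => [//|r IH] rn.
rewrite expnS (leq_trans (leq_mul (leqnn _) (IH (ltnW rn)))) //.
rewrite mulnCA (mulSn n) mulnDr expnS (mulSn r.+1).
by rewrite leq_add2r leq_mul2r rn orbT.
Qed.

(** Integer form of (i - 1) / log i < (p - 1) / log p. Raising [p] by one multiplies the right side
    by [i] and the left side by less than [i]. *)
Lemma expn_predn_lt i p : 1 < i -> i < p -> p ^ i.-1 < i ^ p.-1.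
Proof.
case: i => [|[|i]] // _; case: p => // p; rewrite ltnS /= => ip.
have lt_succ n : i.+1 < n -> n.+1 ^ i.+1 < i.+2 * n ^ i.+1.
  move=> n_i; rewrite expnS.
  have /(leq_mul (leqnn n.+1)) := @expn_succ_le n i (ltnW (ltnW n_i)).
  move=> /leq_ltn_trans; apply; rewrite mulnCA (mulSn n) mulnDr expnS (mulSn i.+1).
  by rewrite ltn_add2r ltn_mul2r n_i andbT expn_gt0 (leq_trans _ n_i).
elim: p ip => // p IH; rewrite leq_eqVlt => /predU1P[[<-]|].
  by rewrite [ltnRHS]expnS lt_succ.
rewrite ltnS => ip; apply: ltn_trans (lt_succ _ (leqW ip)) _.
by rewrite [ltnRHS]expnS ltn_pmul2l // IH.
Qed.

(** Bernoulli: (1 + 1/x)^a >= a/x >= C. Thus a gap of one between bases absorbs any constant factor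
    once [a] is large. *)
Lemma mul_expn_le_expn_succ C x a : 0 < x -> C * x <= a -> C * x ^ a <= x.+1 ^ a.
Proof.
move=> x0; case: a => [|a] Ca.
  by move: Ca; rewrite leqn0 muln_eq0 (gtn_eqF x0) orbF => /eqP->.
have bernoulli b : x ^ b.+1 + b.+1 * x ^ b <= x.+1 ^ b.+1.
  elim: b => [|b IH]; first by rewrite !expn1 expn0 addn1.
  rewrite [leqRHS]expnS; apply: leq_trans (leq_mul (leqnn x.+1) IH).
  rewrite mulnDr [b.+2 * _]mulSn addnA leq_add //.
    by rewrite (mulSn x) -expnS addnC.
  by rewrite mulnCA leq_mul2l expnS leq_mul2r leqnSn !orbT.
apply: leq_trans (bernoulli a); apply: leq_trans (leq_addl _ _).
by rewrite expnS mulnA leq_mul2r Ca orbT.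
Qed.

(** A larger digit sum would give i^(a(p-1)) < C x^a with x = p^(i-1), whereas x + 1 <= i^(p-1)
    forces C x^a <= i^(a(p-1)). The threshold on [a] dominates C x because i - 1 <= p. *)
Lemma digit_sum_le_of_bound i p m a n : 1 < i -> i < p -> 0 < n ->
  n < m.+1 * p ^ a.+1 -> (p ^ 2 * m.+1) ^ p * p ^ p <= a ->
  digit_sum i n <= a * p.-1.
Proof.
move=> i1 ip n0 nlt abig.
have p1 : 1 < p by exact: ltn_trans ip.
have p0 : 0 < p by exact: ltnW.
rewrite leqNgt; apply/negP => lt_s.
have : i ^ (a * p.-1) < (i * n) ^ i.-1.
  by apply: leq_trans (expn_digit_sum_le i n i1 n0); rewrite ltn_exp2l.
apply/negP; rewrite -leqNgt.
set x := p ^ i.-1; pose C := (p ^ 2 * m.+1) ^ i.-1.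
have ui : i.-1 <= p by rewrite (leq_trans (leq_pred _)) // ltnW.
have x0 : 0 < x by rewrite expn_gt0 p0.
have le_C : (i * n) ^ i.-1 <= C * x ^ a.
  rewrite /x /C -expnM (mulnC _ a) expnM -expnMn leq_expn2r //.
  apply: leq_trans (leq_mul (ltnW ip) (ltnW nlt)) _.
  by rewrite expnS (mulnCA m.+1) !mulnA mulnn.
apply: leq_trans le_C _; apply: (@leq_trans (x.+1 ^ a)).
  apply: mul_expn_le_expn_succ => //; apply: leq_trans abig.
  by apply: leq_mul; apply: leq_pexp2l; rewrite // muln_gt0 expn_gt0 p0.
by rewrite mulnC expnM leq_expn2r // expn_predn_lt.
Qed.

Lemma exists_in_A_minus (P : {fset nat}) p k m :
  (forall i, i \in P -> 1 < i) -> p \in P -> (forall i, i \in P -> i <= p) ->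
  1 < k -> 0 < m ->
  exists L W, W < k ^ L /\ in_A_minus P p (m * k ^ L + W).
Proof.
move=> P_gt1 pP p_max k1 m0; have p1 := P_gt1 _ pP.
have p0 : 0 < p by exact: ltnW.
pose a0 := (p ^ 2 * m.+1) ^ p * p ^ p.
(* This [L] gives [p ^ a0 <= k ^ L], hence [a0 <= a]. *)
pose L := p ^ a0; pose a := trunc_log p (k ^ L).
have kL0 : 0 < k ^ L by rewrite expn_gt0 ltnW.
have a0a : a0 <= a by apply: trunc_log_max => //; apply/ltnW/ltn_expl.
have pa0 : 0 < p ^ a by rewrite expn_gt0 p0.
have pa_le : p ^ a <= k ^ L by exact: trunc_logP.
(* The least integer from [m * k ^ L] on that is -1 modulo [p ^ a]; its last [a] base-[p] digits
   alone contribute [a * p.-1]. *)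
pose n := (m * k ^ L) %/ p ^ a * p ^ a + (p ^ a).-1.
have n_ge : m * k ^ L <= n.
  by rewrite {1}(divn_eq (m * k ^ L) (p ^ a)) leq_add2l -ltnS prednK // ltn_mod.
have n_lt : n < m * k ^ L + p ^ a.
  by rewrite -addnS prednK // leq_add2r leq_trunc_div.
have n0 : 0 < n by apply: leq_trans n_ge; rewrite muln_gt0 m0.
exists L, (n - m * k ^ L); split.
  by apply: leq_trans pa_le; rewrite ltn_subLR.
rewrite subnKC //; split=> //.
apply/eqP; rewrite eqn_leq; apply/andP; split; last first.
  exact: (leq_bigmax_seq p pP).
apply/bigmax_leqP_seq => i iP _.
have [->|ne_ip] := eqVneq i p; first by [].
have ip : i < p by rewrite ltn_neqAle ne_ip p_max.
apply: (@leq_trans (a * p.-1)).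
  apply: (@digit_sum_le_of_bound i p m) => //; first exact: P_gt1.
  apply: (leq_trans n_lt); apply: (@leq_trans (m.+1 * k ^ L)).
    by rewrite mulSn addnC leq_add2r.
  by rewrite leq_mul2l ltnW // trunc_log_ltn.
rewrite /n digit_sum_mulXD ?digit_sum_expn_predn ?leq_addl //.
by rewrite prednK.
Qed.

(** The factor [j'] in the modulus makes it exceed [p ^ M * B + W] as soon as [B + W <= j'], so one
    sequence serves all [B] and [W]. *)
Fixpoint euler_exponent (i p j : nat) : nat :=
  if j is j'.+1 then
    let M := euler_exponent i p j' in M + totient (i ^ (j' * p ^ M))
  else 0.

Lemma euler_exponent_ge i p j : 0 < i -> j <= euler_exponent i p j.
Proof.
move=> i0; elim: j => //= j IH; rewrite -addn1 leq_add //.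
by rewrite totient_gt0 expn_gt0 i0.
Qed.

Lemma digit_sum_euler_exponent_ge i p B W j : 1 < i -> 1 < p -> coprime p i ->
  0 < B -> j <= digit_sum i (p ^ euler_exponent i p (B + W + j).+1 * B + W).
Proof.
move=> i1 p1 co_pi B0; have p0 : 0 < p by exact: ltnW.
elim: j => // j IH; rewrite addnS.
set J := (B + W + j).+1 in IH *; set M := euler_exponent i p J in IH.
pose l := J * p ^ M; pose T := totient (i ^ l).
rewrite -[euler_exponent i p J.+1]/(M + T).
have x_lt : p ^ M * B + W < i ^ l.
  apply: leq_ltn_trans (ltn_expl l i1); rewrite /l.
  apply: (@leq_trans ((B + W) * p ^ M)); last first.
    by rewrite leq_mul2r /J -addnS leq_addr orbT.
  by rewrite mulnDl mulnC leq_add2l leq_pmulr // expn_gt0 p0.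
have il0 : 0 < i ^ l by rewrite expn_gt0 ltnW.
have pT : p ^ T = 1 %[mod i ^ l] by apply: Euler_exp_totient; rewrite coprimeXr.
have pT1 : 1 < p ^ T by rewrite -{1}(expn0 p) ltn_exp2l // totient_gt0.
have /dvdnP[y y_eq] : i ^ l %| p ^ T - 1 by rewrite -eqn_mod_dvd ?pT // ltnW.
have y0 : 0 < y.
  by move: pT1; rewrite -subn_gt0 y_eq muln_gt0 => /andP[].
(* The previous number fills the low [l] digits in base [i]; the positive multiple above it adds at
   least one to the digit sum. *)
have -> : p ^ (M + T) * B + W = (p ^ M * B * y) * i ^ l + (p ^ M * B + W).
  rewrite -mulnA -y_eq addnA -[X in _ + X + W]muln1 -mulnDr subnK ?(ltnW pT1) //.
  by rewrite expnD mulnAC.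
rewrite digit_sum_mulXD // -addn1 addnC leq_add //.
by rewrite digit_sum_gt0 // !muln_gt0 expn_gt0 p0 B0.
Qed.

Lemma eventually_in_A_plus (R : realType) (P : {fset nat}) p i (c : R) B W :
  prime p -> prime i -> i \in P -> i != p -> (0 < c)%R -> 0 < B ->
  exists N, forall j, N <= j -> in_A_plus P p c (p ^ euler_exponent i p j * B + W).
Proof.
move=> p_pr i_pr iP ne_ip c0 B0.
have p1 := prime_gt1 p_pr; have i1 := prime_gt1 i_pr.
have co : coprime p i by rewrite prime_coprime // dvdn_prime2 // eq_sym.
(* Once [W < p ^ M], the base-[p] digit sum is that of [B] plus that of [W], whatever [j] is; a
   base-[i] sum of [K] then exceeds it by at least [c]. *)
pose K := Num.bound c + (digit_sum p B + digit_sum p W).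
exists (B + W + K).+1 => j jN; set M := euler_exponent i p j; split.
  by rewrite addn_gt0 muln_gt0 expn_gt0 (ltnW p1) B0.
have WM : W < p ^ M.
  apply: (leq_trans (ltn_expl W p1)); rewrite leq_exp2l //.
  apply: leq_trans (euler_exponent_ge i p j (ltnW i1)).
  by apply: leq_trans jN; rewrite -addnA addnCA -addnS leq_addr.
rewrite (mulnC (p ^ M)) digit_sum_mulXD // -(mulnC (p ^ M)).
rewrite lerBrDr; apply: (@le_trans _ _ K%:R%R).
  by rewrite (natrD _ (Num.bound c)) lerD2r ltW // archi_boundP // ltW.
rewrite ler_nat; apply: (@leq_trans (digit_sum i (p ^ M * B + W))).
  have := @digit_sum_euler_exponent_ge i p B W (j - (B + W).+1) i1 p1 co B0.
  have BWj : B + W < j by apply: leq_trans jN; rewrite ltnS leq_addr.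
  rewrite -(addSn (B + W)) subnKC //.
  by apply: leq_trans; rewrite leq_subRL.
exact: (leq_bigmax_seq i iP).
Qed.

(** The suffix is [W] padded with leading zeros to length [L], hence independent of [m]; positivity
    of [m] keeps those zeros. *)
Lemma digit_word_mulXD k L W : 1 < k -> W < k ^ L ->
  exists w : seq 'I_k, forall m, 0 < m ->
    digit_word k (m * k ^ L + W) = digit_word k m ++ w.
Proof.
move=> k1; have k0 : 0 < k by exact: ltnW.
elim: L W => [|L IH] W WL.
  exists [::] => m m0; move: WL; rewrite expn0 ltnS leqn0 => /eqP->.
  by rewrite muln1 addn0 cats0.
have [|w w_eq] := IH (W %/ k); first by rewrite ltn_divLR // -expnSr.
exists (rcons w (Ordinal (ltn_pmod W k0))) => m m0.
rewrite -rcons_cat -w_eq // /digit_word digitsE //; last first.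
  by rewrite addn_gt0 muln_gt0 m0 expn_gt0 k0.
rewrite expnSr mulnA modnMDl divnMDl // -!cats1 pmap_cat /=; congr cat.
by rewrite /pmap /= insubT ?ltn_pmod //= => lt; congr [:: _]; apply: val_inj.
Qed.

Theorem theorem3p5 (R : realType) (P : {fset nat}) (p : nat) (c : R)
  (P_prime : forall i : nat, i \in P -> prime i)
  (P_card : 2 <= #|` P|)
  (p_in : p \in P)
  (p_max : forall i : nat, i \in P -> i <= p)
  (c_gt0 : (0 < c)%R) :
  ~ exists (k : nat) (M : DFAO 'I_k) (a b : dfao_output M),
      [/\ 2 <= k,
          a <> b,
          forall n : nat, in_A_minus P p n -> dfao_eval M (digit_word k n) = a
        & forall n : nat, in_A_plus P p c n -> dfao_eval M (digit_word k n) = b].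
Proof.
move=> [k [M [a [b [k1 ne_ab outa outb]]]]].
have p_pr := P_prime _ p_in; have p0 := prime_gt0 p_pr.
have [i iP ne_ip] : exists2 i, i \in P & i != p.
  have : 0 < #|` P `\ p|%fset by move: P_card; rewrite (cardfsD1 p) p_in.
  by rewrite cardfs_gt0 => /fset0Pn[i]; rewrite in_fsetD1 => /andP[? ?]; exists i.
have i_pr := P_prime _ iP.
pose x j := p ^ euler_exponent i p j.
have x0 j : 0 < x j by rewrite expn_gt0 p0.
pose g j := dfao_run (dfao_init M) (digit_word k (x j)).
(* If [x j0] and a later [x j] both lead to [q], reading the same suffix [w] from [q] would output
   both [a] and [b]. *)
have finitely_often (q : dfao_state M) : exists N, forall j, N <= j -> g j <> q.
  case: (EM (exists j, g j = q)) => [[j0 gj0]|no]; last first.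
    by exists 0 => j _ gj; apply: no; exists j.
  have [|L [W [WL nA]]] := @exists_in_A_minus P p k (x j0) _ p_in p_max k1 (x0 j0).
    by move=> l /P_prime/prime_gt1.
  have [w w_eq] := digit_word_mulXD k L W k1 WL.
  have kL0 : 0 < k ^ L by rewrite expn_gt0 ltnW.
  have [N NA] := @eventually_in_A_plus R P p i c _ W p_pr i_pr iP ne_ip c_gt0 kL0.
  exists N => j /NA/outb eb gj; apply: ne_ab; rewrite -(outa _ nA) -eb.
  rewrite /dfao_eval (w_eq _ (x0 j0)) (w_eq _ (x0 j)) /dfao_run !foldl_cat.
  by move: gj gj0; rewrite /g /dfao_run => -> ->.
have [N N_all] := fin_all_exists finitely_often.
(* Past every state's threshold, the state [g J] itself included. *)
pose J := \max_q N q.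
by apply: (N_all (g J) J) => //; apply: leq_bigmax.
Qed.
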